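(* The group $(\mathbb{G},d)$, which is also a non-periodic abelian group (i.e. it has elements of infinite order) isometric to the Urysohn universal space, is not isometrically isomorphic to the Shkarin/Niemiec group $G_{\mathrm{SN}}$, and it is not isometrically isomorphic to any Cameron–Vershik group $G_{\mathrm{CV}}$.
   Context: Finitely generated metrics. A metric $d$ on an abelian group $G$ is finitely generated if there is a finite set $A\subseteq G^2$ such that for all $a,b\in G$, $d(a,b)=\min\{d(a_1,b_1)+\ldots+d(a_n,b_n): n\in\mathbb{N},\ (a_i,b_i)\in A \text{ for } i\le n,\ a=a_1+\ldots+a_n,\ b=b_1+\ldots+b_n\}$; in particular every pair $(a,b)\in G^2$ admits at least one such decomposition. Such a metric is automatically invariant. It is rational if it takes values in $\mathbb{Q}$. The class $\mathcal{G}$. Elements of $\mathcal{G}$ are the groups $\mathbb{Z}^n$ (with their distinguished free generators) equipped with finitely generated rational metrics. The set $\mathcal{M}$ of morphisms consists of the isometric group monomorphisms $f:K\to H$ ($K,H\in\mathcal{G}$) that send the distinguished free generators of $K$ to distinguished free generators of $H$. Write $K\sqsubseteq H$ if there is a morphism in $\mathcal{M}$ from $K$ to $H$. The group $\mathbb{G}$. Let $(G,d)$ be the Fraïssé limit of $(\mathcal{G},\mathcal{M})$, i.e. the unique, up to isometric isomorphism, countable abelian group with invariant metric such that: (1) $G$ is a direct limit of a sequence $K_1\sqsubseteq K_2\sqsubseteq\ldots$ of members of $\mathcal{G}$ with connecting maps in $\mathcal{M}$; (2) every $A\in\mathcal{G}$ admits a morphism in $\mathcal{M}$ into some $K_m$;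 (3) for any $A_1,A_2\in\mathcal{G}$ and $\iota_1:A_1\to K_n$, $\rho:A_1\to A_2$ in $\mathcal{M}$ there are $m>n$ and $\iota_2:A_2\to K_m$ in $\mathcal{M}$ with $\iota_2\circ\rho=\iota_1$. $(\mathbb{G},d)$ is the metric completion of $(G,d)$ with the extended operations and metric. The Urysohn universal space is the unique (up to isometry) complete separable metric space $U$ that contains an isometric copy of every separable metric space and in which every isometry between finite subsets extends to an isometry of $U$ onto itself. The rational Urysohn space is the unique (up to isometry) countable metric space $X$ with rational distances such that for every finite $A\subseteq X$ and every $f:A\to\mathbb{Q}^+$ (positive rationals) with $|f(a)-f(b)|\le d_X(a,b)\le f(a)+f(b)$ for all $a,b\in A$, there is $x\in X$ with $d_X(a,x)=f(a)$ for all $a\in A$. The Shkarin/Niemiec group $(G_{\mathrm{SN}},d_{\mathrm{SN}})$ is the metric completion of the Fraïssé limit of the class of finite abelian groups with rational-valued invariant metrics (embeddings being all isometric group monomorphisms); that is, the completion of the unique (up to isometric isomorphism) countable abelian torsion group $S$ with rational-valued invariant metric such that for all finite abelian groups $A_1\le A_2$ with rational-valued invariant metrics (the metric of $A_2$ extending that of $A_1$), every isometric homomorphism $A_1\to S$ extends to an isometric homomorphism $A_2\to S$. A Cameron–Vershik group $(G_{\mathrm{CV}},d_{\mathrm{CV}})$ is the metric completion of $(\mathbb{Z},\rho)$, where $\rho$ is an invariant metric on the group $\mathbb{Z}$ such that $(\mathbb{Z},\rho)$ is isometric to the rational Urysohn space (so it contains an element $x$ whose orbit $\{n\cdot x:n\in\mathbb{Z}\}$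 is dense and isometric to the rational Urysohn space). These groups form a family of continuum many groups. *)

(* Defs.v *)
From HB Require Import structures.
From mathcomp Require Import all_boot all_order all_algebra.
From mathcomp Require Import all_classical reals.

Set Implicit Arguments.
Unset Strict Implicit.
Unset Printing Implicit Defensive.

Import Order.TTheory GRing.Theory Num.Theory.
Local Open Scope classical_set_scope.
Local Open Scope ring_scope.

(* Distances are plain functions rather than [metricType] structures because
   the same group (Z or Z^n) carries many different metrics at once. *)

Definition is_metric (R : realType) (T : Type) (d : T -> T -> R) : Prop :=
  [/\ forall x y, 0 <= d x y,
      forall x y, d x y = 0 <-> x = y,
      forall x y, d x y = d y x &
      forall x y z, d x z <= d x y + d y z].

Definition is_invariant (R : realType) (G : zmodType) (d : G -> G -> R) : Prop :=
  forall z x y, d (x + z) (y + z) = d x y.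

Definition rational_valued (R : realType) (T : Type) (d : T -> T -> R) : Prop :=
  forall x y, exists q : rat, d x y = ratr q.

Definition is_isometry (R : realType) (X Y : Type)
    (dX : X -> X -> R) (dY : Y -> Y -> R) (f : X -> Y) : Prop :=
  forall x y, dY (f x) (f y) = dX x y.

Definition isometric (R : realType) (X Y : Type)
    (dX : X -> X -> R) (dY : Y -> Y -> R) : Prop :=
  exists f : X -> Y, is_isometry dX dY f /\ forall y, exists x, f x = y.

Definition isometrically_isomorphic (R : realType) (G H : zmodType)
    (dG : G -> G -> R) (dH : H -> H -> R) : Prop :=
  exists f : {additive G -> H}, is_isometry dG dH f /\ forall y, exists x, f x = y.

Definition dense_in (R : realType) (T : Type) (d : T -> T -> R) (D : set T) : Prop :=
  forall x (e : R), 0 < e -> exists2 y, D y & d x y < e.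

Definition separable (R : realType) (T : Type) (d : T -> T -> R) : Prop :=
  exists2 D : set T, countable D & dense_in d D.

Definition complete (R : realType) (T : Type) (d : T -> T -> R) : Prop :=
  forall u : nat -> T,
    (forall e : R, 0 < e ->
       exists N, forall m n, (N <= m)%N -> (N <= n)%N -> d (u m) (u n) < e) ->
    exists l, forall e : R, 0 < e ->
       exists N, forall n, (N <= n)%N -> d (u n) l < e.

(* Since [dG] is invariant, addition on [G] is continuous, hence it is the
   unique continuous extension of the addition of the dense subgroup [j @` H]. *)
Definition is_completion (R : realType) (H G : zmodType)
    (dH : H -> H -> R) (dG : G -> G -> R) : Prop :=
  [/\ is_metric dG, is_invariant dG, complete dG &
      exists j : {additive H -> G}, is_isometry dH dG j /\ dense_in dG (range j)].

(* Finite partial isometries of [U] are given by a total function [f] whose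
   values outside the finite set [A] are irrelevant. *)
Definition is_urysohn (R : realType) (U : Type) (dU : U -> U -> R) : Prop :=
  [/\ is_metric dU,
      complete dU,
      separable dU,
      forall (X : Type) (dX : X -> X -> R), is_metric dX -> separable dX ->
        exists f : X -> U, is_isometry dX dU f &
      forall (A : set U) (f : U -> U), finite_set A ->
        (forall x y, A x -> A y -> dU (f x) (f y) = dU x y) ->
        exists g : U -> U, [/\ is_isometry dU dU g,
          forall y, exists x, g x = y & forall x, A x -> g x = f x]].

Definition is_rational_urysohn (R : realType) (X : Type) (dX : X -> X -> R) : Prop :=
  [/\ is_metric dX,
      countable [set: X],
      rational_valued dX &
      forall (A : set X) (f : X -> rat), finite_set A ->
        (forall a, A a -> 0 < f a) ->
        (forall a b, A a -> A b ->
           ratr `|f a - f b| <= dX a b /\ dX a b <= ratr (f a + f b)) ->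
        exists x, forall a, A a -> dX a x = ratr (f a)].

Definition isometric_to_urysohn (R : realType) (T : Type) (d : T -> T -> R) : Prop :=
  exists (U : Type) (dU : U -> U -> R), is_urysohn dU /\ isometric d dU.

Definition isometric_to_rational_urysohn (R : realType) (T : Type)
    (d : T -> T -> R) : Prop :=
  exists (X : Type) (dX : X -> X -> R), is_rational_urysohn dX /\ isometric d dX.

Definition decomposes (G : zmodType) (A s : seq (G * G)) (a b : G) : Prop :=
  [/\ {subset s <= A}, \sum_(p <- s) p.1 = a & \sum_(p <- s) p.2 = b].

Definition finitely_generated (R : realType) (G : zmodType) (d : G -> G -> R) : Prop :=
  exists A : seq (G * G), forall a b,
    (exists2 s, decomposes A s a b & d a b = \sum_(p <- s) d p.1 p.2) /\
    (forall s, decomposes A s a b -> d a b <= \sum_(p <- s) d p.1 p.2).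

(* The class of groups Z^n with a finitely generated rational metric; the
   distinguished free generators are the unit vectors. *)
Record fgq_group (R : realType) := FgqGroup {
  rk : nat;
  dist : 'rV[int]_rk -> 'rV[int]_rk -> R;
  dist_metric : is_metric dist;
  dist_fg : finitely_generated dist;
  dist_rational : rational_valued dist }.

Definition carrier (R : realType) (K : fgq_group R) : zmodType := 'rV[int]_(rk K).

Definition gen (R : realType) (K : fgq_group R) (i : 'I_(rk K)) : carrier K :=
  delta_mx 0 i.

Definition is_morphism (R : realType) (K H : fgq_group R)
    (f : {additive carrier K -> carrier H}) : Prop :=
  [/\ injective f, is_isometry (@dist R K) (@dist R H) f &
      forall i, exists j, f (gen i) = gen j].

(* The composite connecting map K_n -> K_(k + n). *)
Fixpoint connect_map (R : realType) (K : nat -> fgq_group R)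
    (c : forall n, {additive carrier (K n) -> carrier (K n.+1)})
    (n k : nat) : carrier (K n) -> carrier (K (k + n)%N) :=
  match k with
  | 0 => fun x => x
  | k'.+1 => fun x => c (k' + n)%N (connect_map c k' x)
  end.

(* An isometric direct limit: the legs [g n] are automatically injective, and
   they jointly cover the limit. *)
Definition is_direct_limit (R : realType) (K : nat -> fgq_group R)
    (c : forall n, {additive carrier (K n) -> carrier (K n.+1)})
    (G : zmodType) (d : G -> G -> R) : Prop :=
  exists g : forall n, {additive carrier (K n) -> G},
    [/\ forall n, is_isometry (@dist R (K n)) d (g n),
        forall n x, g n.+1 (c n x) = g n x &
        forall y, exists n x, g n x = y].

Definition is_fraisse_limit (R : realType) (G : zmodType) (d : G -> G -> R) : Prop :=
  exists (K : nat -> fgq_group R)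
         (c : forall n, {additive carrier (K n) -> carrier (K n.+1)}),
    [/\ forall n, is_morphism (c n),
        is_direct_limit c d,
        forall A : fgq_group R,
          exists m (f : {additive carrier A -> carrier (K m)}), is_morphism f &
        forall (A1 A2 : fgq_group R) n
               (iota1 : {additive carrier A1 -> carrier (K n)})
               (rho : {additive carrier A1 -> carrier A2}),
          is_morphism iota1 -> is_morphism rho ->
          exists k (iota2 : {additive carrier A2 -> carrier (K (k.+1 + n)%N)}),
            is_morphism iota2 /\
            forall x, iota2 (rho x) = connect_map c k.+1 (iota1 x)].

Definition is_GG (R : realType) (G : zmodType) (d : G -> G -> R) : Prop :=
  exists (L : zmodType) (dL : L -> L -> R), is_fraisse_limit dL /\ is_completion dL d.

Definition is_SN_countable (R : realType) (S : zmodType) (dS : S -> S -> R) : Prop :=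
  [/\ is_metric dS /\ is_invariant dS,
      countable [set: S],
      forall x : S, exists2 n, (0 < n)%N & x *+ n = 0,
      rational_valued dS &
      forall (A1 A2 : finZmodType) (d1 : A1 -> A1 -> R) (d2 : A2 -> A2 -> R)
             (i : {additive A1 -> A2}) (f : {additive A1 -> S}),
        is_metric d1 -> is_invariant d1 -> rational_valued d1 ->
        is_metric d2 -> is_invariant d2 -> rational_valued d2 ->
        is_isometry d1 d2 i -> is_isometry d1 dS f ->
        exists h : {additive A2 -> S},
          is_isometry d2 dS h /\ forall x, h (i x) = f x].

Definition is_SN (R : realType) (G : zmodType) (d : G -> G -> R) : Prop :=
  exists (S : zmodType) (dS : S -> S -> R), is_SN_countable dS /\ is_completion dS d.

Definition is_CV (R : realType) (G : zmodType) (d : G -> G -> R) : Prop :=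
  exists rho : int -> int -> R,
    [/\ is_metric rho, is_invariant rho, isometric_to_rational_urysohn rho &
        is_completion rho d].

Definition non_periodic (G : zmodType) : Prop :=
  exists x : G, forall n, (0 < n)%N -> x *+ n <> 0.

(* Main.v *)
Require Import Defs.
From HB Require Import structures.
From mathcomp Require Import all_boot all_order all_algebra.
From mathcomp Require Import all_classical reals.
From mathcomp Require Import ring lra zify.

(* Given a finitely generated rational metric on K = Z^n, points a of K and
   rationals r_a with r_a + r_b >= d(a, b), let K + Z x carry the largest
   invariant metric with d(x, a) <= r_a. It is again finitely generated, it
   extends d, and d(x, b) is the minimum of r_a + d(a, b). So rational Katetov
   functions on finite subsets of the Fraisse limit are realized up to any
   error, hence the completion realizes all real Katetov functions, and the
   back-and-forth method makes it a Urysohn space.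

   The group Z^2 with the l1 metric embeds in G; let x, y be the images of its
   generators. If t is torsion, n t = 0 and d(x, t) < 1/2, then
   n = d(n x, n t) <= n d(x, t) < n, so torsion elements are not dense in G. If
   a z, b z are multiples of one element z with d(x, a z), d(y, b z) < 1/2, then
   |a| + |b| = d(b x, a y) <= (|a| + |b|)/2, so a = 0, against d(x, 0) = 1;
   hence no cyclic subgroup of G is dense. *)

Set Implicit Arguments.
Unset Strict Implicit.
Unset Printing Implicit Defensive.
Import Order.TTheory GRing.Theory Num.Theory.
Local Open Scope classical_set_scope.
Local Open Scope ring_scope.

(** * Finitely generated metrics from weighted generators *)

(** An optimal decomposition of [(z, z)] has cost 0, so appending it to an optimal one of [(x, y)]
    does not raise the cost. Translation by [- z] gives the reverse inequality. *)
Lemma finitely_generated_invariant (R : realType) (G : zmodType)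
    (d : G -> G -> R) :
  is_metric d -> finitely_generated d -> is_invariant d.
Proof.
move=> [_ d0 _ _] [A dA].
have le z x y : d (x + z) (y + z) <= d x y.
  have [[s [sA s1 s2] ->] _] := dA x y.
  have [[t [tA t1 t2] dt] _] := dA z z.
  have [_ /(_ (s ++ t))] := dA (x + z) (y + z).
  rewrite big_cat /= -dt (d0 z z).2// addr0; apply.
  split=> [p||].
  - by rewrite mem_cat => /orP[/sA|/tA].
  - by rewrite big_cat /= s1 t1.
  - by rewrite big_cat /= s2 t2.
move=> z x y; apply/le_anti; rewrite le /=.
by rewrite -{1}(addrK z x) -{1}(addrK z y) le.
Qed.

(** Finitely many rational costs become natural multiples of one unit; minimal costs then exist by
    well-ordering. *)
Lemma common_denominator (s : seq rat) :
  exists2 N : nat, (0 < N)%N &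
    forall x, x \in s -> 0 <= x -> exists m : nat, x = N%:R^-1 * m%:R.
Proof.
elim: s => [|y s [N N0 IH]]; first by exists 1%N.
have dy : (0 < `|denq y|)%N by rewrite absz_gt0 denq_neq0.
have dE : (`|denq y|%N)%:R = (denq y)%:~R :> rat.
  by rewrite natr_absz gtr0_norm.
exists (N * `|denq y|)%N; first by rewrite muln_gt0 N0.
move=> x; rewrite inE => /orP[/eqP-> y0|xs x0].
- exists (`|numq y| * N)%N; rewrite !natrM dE.
  have -> : (`|numq y|%N)%:R = (numq y)%:~R :> rat.
    by rewrite natr_absz ger0_norm// numq_ge0.
  rewrite -{1}(divq_num_den y); field.
  by rewrite intr_eq0 denq_neq0 pnatr_eq0 -lt0n N0.
- have [m ->] := IH x xs x0; exists (m * `|denq y|)%N; rewrite !natrM dE; field.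
  by rewrite intr_eq0 denq_neq0 pnatr_eq0 -lt0n N0.
Qed.

(** A pair in [W] is a generator with its cost, and [s] is a word in these letters. The least
    [total_weight] of a word for [v] is a weighted word length. *)
Definition weighted_decomposition (V : zmodType) (W s : seq (V * nat)) (v : V) :=
  {subset s <= W} /\ \sum_(w <- s) w.1 = v.

Definition total_weight (V : zmodType) (s : seq (V * nat)) : nat :=
  (\sum_(w <- s) w.2)%N.

Lemma weighted_decomposition_cat (V : zmodType) (W s t : seq (V * nat)) (u v : V) :
  weighted_decomposition W s u -> weighted_decomposition W t v ->
  weighted_decomposition W (s ++ t) (u + v).
Proof.
move=> [sW <-] [tW <-]; split; last by rewrite big_cat.
by move=> w; rewrite mem_cat => /orP[/sW|/tW].
Qed.

Lemma weighted_decomposition_mulrz (V : zmodType) (W : seq (V * nat)) (w : V * nat)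
    (z : int) :
  w \in W -> (- w.1, w.2) \in W -> exists s, weighted_decomposition W s (w.1 *~ z).
Proof.
have decMn (w' : V * nat) n : w' \in W ->
    exists s, weighted_decomposition W s (w'.1 *+ n).
  move=> wW; exists (nseq n w'); split; first by move=> _ /nseqP[->].
  by rewrite big_nseq iter_addr addr0.
case: z => n wW oW; first exact: decMn.
by rewrite NegzE mulrNz -mulNrn; exact: (decMn (- w.1, w.2) n.+1).
Qed.

Lemma total_weight_cat (V : zmodType) (s t : seq (V * nat)) :
  total_weight (s ++ t) = (total_weight s + total_weight t)%N.
Proof. exact: big_cat. Qed.

Lemma minimal_weight (V : zmodType) (W : seq (V * nat)) :
  (forall v, exists s, weighted_decomposition W s v) ->
  exists q : V -> nat,
    (forall v, exists2 s, weighted_decomposition W s v & q v = total_weight s) /\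
    (forall v s, weighted_decomposition W s v -> (q v <= total_weight s)%N).
Proof.
move=> gen.
suff /choice[q qP] : forall v, exists n,
    (exists2 s, weighted_decomposition W s v & n = total_weight s) /\
    (forall s, weighted_decomposition W s v -> (n <= total_weight s)%N).
  by exists q; split=> v; have [] := qP v.
move=> v.
pose P n := `[< exists2 s, weighted_decomposition W s v & n = total_weight s >].
have exP : exists n, P n.
  by have [s sv] := gen v; exists (total_weight s); apply/asboolP; exists s.
case: (ex_minnP exP) => n /asboolP Pn le_n; exists n; split=> // s sv.
by apply: le_n; apply/asboolP; exists s.
Qed.

(** The weighted word length, scaled by [c], is a norm: concatenation gives subadditivity, closure
    of [W] under opposites gives symmetry, and a word of weight 0 has only zero letters. *)
Lemma weighted_metric (R : realType) (V : zmodType) (W : seq (V * nat)) (c : rat) :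
  0 < c -> (forall w, w \in W -> (- w.1, w.2) \in W) ->
  (forall w, w \in W -> w.2 = 0%N -> w.1 = 0) ->
  (forall v, exists s, weighted_decomposition W s v) ->
  exists d : V -> V -> R,
    [/\ is_metric d, finitely_generated d, rational_valued d,
        forall v, exists2 s, weighted_decomposition W s v &
          d v 0 = ratr c * (total_weight s)%:R &
        forall v s, weighted_decomposition W s v ->
          d v 0 <= ratr c * (total_weight s)%:R].
Proof.
move=> c0 Wsym Wpos gen.
have [q [q_dec q_min]] := minimal_weight gen.
have rc0 : 0 < ratr c :> R by rewrite ltr0q.
have qN v : (q (- v) <= q v)%N.
  have [s [sW <-] ->] := q_dec v.
  have -> : total_weight s = total_weight [seq (- w.1, w.2) | w <- s].
    by rewrite /total_weight big_map.
  apply: q_min; split; last by rewrite big_map /= sumrN.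
  by move=> _ /mapP[w ws ->]; apply/Wsym/sW.
have qD u v : (q (u + v)%R <= q u + q v)%N.
  have [s us ->] := q_dec u; have [t vt ->] := q_dec v.
  by rewrite -total_weight_cat; apply/q_min/weighted_decomposition_cat.
have q00 : q 0 = 0%N.
  apply/eqP; rewrite -leqn0 (_ : 0%N = total_weight (Nil (V * nat))) ?q_min//.
    by split=> //; rewrite big_nil.
  by rewrite /total_weight big_nil.
have q_eq0 v : q v = 0%N -> v = 0.
  have [s [sW <-] ->] := q_dec v => /eqP; rewrite sum_nat_seq_eq0 => /allP s0.
  rewrite big_seq big1// => w ws; apply: Wpos; first exact: sW.
  exact/eqP/s0.
pose d a b : R := ratr c * (q (a - b))%:R.
have met : is_metric d.
  split=> [x y|x y|x y|x y z].
  - by rewrite mulr_ge0// ltW.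
  - split=> [/eqP|->]; last by rewrite /d subrr q00 mulr0.
    rewrite mulf_eq0 gt_eqF//= pnatr_eq0 => /eqP /q_eq0 /eqP.
    by rewrite subr_eq0 => /eqP.
  - congr (_ * _%:R); apply/eqP; rewrite eqn_leq.
    by rewrite -{1}(opprB y x) qN -(opprB x y) qN.
  - rewrite -mulrDr ler_pM2l// -natrD ler_nat.
    by rewrite (_ : x - z = (x - y) + (y - z)) ?qD// addrA subrK.
have d_sum (s : seq (V * V)) :
    d (\sum_(p <- s) p.1) (\sum_(p <- s) p.2) <= \sum_(p <- s) d p.1 p.2.
  elim: s => [|p s IH]; first by rewrite !big_nil /d subrr q00 mulr0.
  rewrite !big_cons; apply: le_trans (lerD (lexx _) IH).
  by rewrite -mulrDr ler_pM2l// -natrD ler_nat opprD addrACA qD.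
exists d; split=> //.
(* Write [(a, b)] as [(a - b, 0) + (b, b)]: the pairs [(w, 0)] generate the first summand at the
   right cost, the pairs [(w, w)] the second at cost 0. *)
- exists ([seq (w.1, 0) | w <- W] ++ [seq (w.1, w.1) | w <- W]) => a b; split.
    have [s [sW sE] qE] := q_dec (a - b); have [t [tW tE] _] := q_dec b.
    exists ([seq (w.1, 0) | w <- s] ++ [seq (w.1, w.1) | w <- t]).
      split.
      + move=> p; rewrite !mem_cat => /orP[] /mapP[w ws ->]; apply/orP.
          by left; apply/mapP; exists w => //; exact: sW.
        by right; apply/mapP; exists w => //; exact: tW.
      + by rewrite big_cat !big_map /= sE tE subrK.
      + by rewrite big_cat !big_map /= big1// add0r tE.
    apply/le_anti/andP; split.
      have := d_sum ([seq (w.1, 0) | w <- s] ++ [seq (w.1, w.1) | w <- t]).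
      by rewrite !big_cat !big_map /= sE tE [X in d _ (X + _)]big1// add0r subrK.
    rewrite big_cat !big_map /= [X in _ + X]big1 ?addr0; last first.
      by move=> w _; rewrite /d subrr q00 mulr0.
    rewrite /d qE -mulr_sumr ler_pM2l// -natr_sum ler_nat.
    rewrite /total_weight big_seq [leqRHS]big_seq leq_sum// => w ws.
    rewrite subr0 -[leqRHS](_ : total_weight [:: w] = _).
      rewrite q_min//; split; last by rewrite big_seq1.
      by move=> z; rewrite inE => /eqP->; exact: sW.
    by rewrite /total_weight big_seq1.
  by move=> s [_ <- <-]; exact: d_sum.
- by move=> x y; exists (c * (q (x - y))%:R); rewrite rmorphM /= ratr_nat.
- move=> v; have [s vs qE] := q_dec v; exists s => //.
  by rewrite /d subr0 qE.
- by move=> v s vs; rewrite /d subr0 ler_pM2l// ler_nat q_min.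
Qed.

(** * One-point extensions *)

Lemma invariant_subr0 (R : realType) (G : zmodType) (d : G -> G -> R) :
  is_invariant d -> forall x y, d (x - y) 0 = d x y.
Proof. by move=> dI x y; rewrite -(dI y) subrK add0r. Qed.

Lemma invariant_norm_opp (R : realType) (G : zmodType) (d : G -> G -> R) :
  is_metric d -> is_invariant d -> forall x, d (- x) 0 = d x 0.
Proof. by move=> [_ _ dC _] dI x; rewrite -(dI x) addNr add0r dC. Qed.

Lemma invariant_normD (R : realType) (G : zmodType) (d : G -> G -> R) :
  is_metric d -> is_invariant d -> forall x y, d (x + y) 0 <= d x 0 + d y 0.
Proof.
move=> [_ _ dC dT] dI x y; apply: le_trans (dT _ y _) _.
by rewrite -[X in d _ X + _]add0r dI.
Qed.

(* The chain [t] collects the occurrences of the new generator [x] left after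
   cancelling every pair [x - a], [b - x] at the cost [d a b]. *)
Lemma one_point_lower_bound (R : realType) (K V : zmodType) (d : K -> K -> R)
    (c : R) (l : seq (K * rat)) (W : seq (V * nat)) (pi : V -> K) (mu : V -> int) :
  is_metric d -> is_invariant d ->
  (forall a b, a \in l -> b \in l -> d a.1 b.1 <= ratr (a.2 + b.2)) ->
  pi 0 = 0 -> (forall u v, pi (u + v) = pi u + pi v) ->
  mu 0 = 0 -> (forall u v, mu (u + v) = mu u + mu v) ->
  (forall w, w \in W ->
     mu w.1 = 0 /\ d (pi w.1) 0 <= c * w.2%:R \/
     exists a (e : int), [/\ a \in l, e = 1 \/ e = -1, pi w.1 = - (a.1 *~ e),
                           mu w.1 = e & ratr a.2 <= c * w.2%:R]) ->
  forall s v, weighted_decomposition W s v ->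
    exists (e : int) (t : seq (K * rat)),
      [/\ {subset t <= l}, e = 1 \/ e = -1, mu v = e * (size t)%:Z &
          d (pi v + (\sum_(a <- t) a.1) *~ e) 0 + \sum_(a <- t) ratr a.2
            <= c * (total_weight s)%:R].
Proof.
move=> dM dI lK pi0 piD mu0 muD WP s v [+ <-] {v}.
have nN := invariant_norm_opp dM dI; have nD := invariant_normD dM dI.
have [_ d0 dC _] := dM.
elim: s => [_|w s IH ws].
  exists 1, [::]; rewrite /total_weight !big_nil; split=> //; first by left.
  by rewrite pi0 mul0rz !addr0 mulr0 (d0 0 0).2.
have sW : {subset s <= W} by move=> z zs; rewrite ws// inE zs orbT.
have [e [t [tl e1 muE bound]]] := IH sW.
have ww : w \in W by rewrite ws// mem_head.
rewrite /total_weight !big_cons natrD mulrDr -!/(total_weight _).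
rewrite piD muD muE.
have [[-> wc]|[a [h [al h1 -> -> ac]]]] := WP _ ww.
  exists e, t; split=> //; first by rewrite add0r.
  rewrite -addrA; apply: le_trans (lerD (nD _ _) (lexx _)) _.
  by rewrite -addrA lerD.
have [eh|eh] := eqVneq h e.
  exists e, (a :: t); rewrite !big_cons; split=> //=.
  - by move=> z; rewrite inE => /orP[/eqP->|/tl].
  - by rewrite eh intS mulrDr mulr1.
  - rewrite mulrzDl eh addrACA addNr add0r.
    by rewrite addrCA lerD.
have {}eh : e = - h by case: e1 h1 eh => -> [] ->.
(* The sign of an empty chain carries no information, so the chain restarts with the sign [h] of the
   new letter. Otherwise the new letter cancels against the head [b]. *)
case: t => [|b t] in tl muE bound *.
  exists h, [:: a]; rewrite !big_cons !big_nil; split=> //=.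
  - by move=> z; rewrite inE => /eqP->.
  - by rewrite mulr0 mulr1 addr0.
  - move: bound; rewrite !big_nil mul0rz !addr0 => bound.
    by rewrite addrAC addNr add0r addrC lerD.
exists e, t; split=> //=.
- by move=> z zt; rewrite tl// inE zt orbT.
- by rewrite intS eh; ring.
have bl : b \in l by rewrite tl// mem_head.
move: bound; rewrite !big_cons /= => bound.
have -> : - (a.1 *~ h) + pi (\sum_(w <- s) w.1) + (\sum_(a <- t) a.1) *~ e =
    (pi (\sum_(w <- s) w.1) + (b.1 + \sum_(a <- t) a.1) *~ e) + (a.1 - b.1) *~ e.
  have -> : - (a.1 *~ h) = a.1 *~ e by rewrite eh mulrNz.
  rewrite mulrzDl mulrzBl; set A := a.1 *~ e; set B := b.1 *~ e.
  set P := pi _; set T := _ *~ e.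
  by rewrite (addrC A (- B)) (addrC B T) !addrA addrK -[LHS]addrA [LHS]addrC.
(* The weight of [b], released from the chain, and that of the new letter together pay for the
   distance between [a] and [b]. *)
have ab : d ((a.1 - b.1) *~ e) 0 <= ratr a.2 + ratr b.2.
  rewrite -rmorphD /=; apply: le_trans (lK _ _ al bl).
  by case: e1 => ->; rewrite ?mulrNz ?nN mulr1z invariant_subr0.
have := nD (pi (\sum_(w <- s) w.1) + (b.1 + \sum_(a <- t) a.1) *~ e)
  ((a.1 - b.1) *~ e).
lra.
Qed.

Definition append0 (n : nat) (u : 'rV[int]_n) : 'rV[int]_(n + 1) := row_mx u 0.

Lemma append0_is_zmod_morphism (n : nat) : zmod_morphism (@append0 n).
Proof. by move=> u v; rewrite /append0 opp_row_mx add_row_mx subr0. Qed.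

HB.instance Definition _ (n : nat) :=
  GRing.isZmodMorphism.Build _ _ (@append0 n) (@append0_is_zmod_morphism n).

(** [K'] carries the word metric of the letters [p.1 - p.2], for [p] in a generating set of [K], and
    [x - a] at cost [r_a], with their opposites. Explicit words give the upper bounds. On a minimal
    word, [one_point_lower_bound] leaves an empty chain when the coefficient of [x] is 0, which
    gives the isometry, and a single [b] when it is 1, which gives [r_b + d(b, a)]. *)
Lemma one_point_extension (R : realType) (K : fgq_group R)
    (l : seq (carrier K * rat)) :
  l <> [::] -> (forall a, a \in l -> 0 < a.2) ->
  (forall a b, a \in l -> b \in l -> @dist R K a.1 b.1 <= ratr (a.2 + b.2)) ->
  exists (K' : fgq_group R) (rho : {additive carrier K -> carrier K'})
         (x : carrier K'),
    [/\ is_morphism rho,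
        forall a, a \in l -> dist x (rho a.1) <= ratr a.2 &
        forall a, a \in l ->
          exists2 b, b \in l & ratr b.2 + @dist R K b.1 a.1 <= dist x (rho a.1)].
Proof.
move=> l0 lpos lK.
have [a0 a0l] : exists a, a \in l.
  by case: l l0 {lpos lK} => // a l _; exists a; exact: mem_head.
have dM := dist_metric K; have dI := finitely_generated_invariant dM (dist_fg K).
have [dge0 d0 dC dT] := dM.
have [A dA] := dist_fg K.
have /choice[qd qdE] : forall p : carrier K * carrier K, exists q : rat,
  @dist R K p.1 p.2 = ratr q by move=> p; exact: dist_rational.
pose weights := [seq qd p | p <- A] ++ [seq a.2 | a <- l].
have [N N0 NP] := common_denominator weights.
have /choice[m mE] : forall x : rat, exists m : nat,
    x \in weights -> 0 <= x -> x = N%:R^-1 * m%:R.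
  move=> x; case: (boolP ((x \in weights) && (0 <= x))) => [/andP[xw x0]|].
    by have [k ->] := NP x xw x0; exists k.
  by rewrite negb_and => nx; exists 0%N => xw x0; rewrite xw x0 in nx.
pose c : rat := N%:R^-1.
have c0 : 0 < c by rewrite invr_gt0 ltr0n.
have rc0 : 0 < ratr c :> R by rewrite ltr0q.
have mA p : p \in A -> @dist R K p.1 p.2 = ratr c * (m (qd p))%:R.
  move=> pA; rewrite qdE {1}(mE (qd p)) ?rmorphM /= ?ratr_nat//.
    by rewrite mem_cat map_f.
  by rewrite -(ler0q R) -qdE.
have ml a : a \in l -> ratr a.2 = ratr c * (m a.2)%:R :> R.
  move=> al; rewrite {1}(mE a.2) ?rmorphM /= ?ratr_nat//.
    by rewrite mem_cat map_f ?orbT.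
  exact/ltW/lpos.
pose x : 'rV[int]_(rk K + 1) := row_mx 0 1.
pose WA := [seq (append0 (p.1 - p.2), m (qd p)) | p <- A].
pose Wl := [seq (x - append0 a.1, m a.2) | a <- l].
pose opp (w : 'rV[int]_(rk K + 1) * nat) := (- w.1, w.2).
pose W := (WA ++ Wl) ++ map opp (WA ++ Wl).
have WP w : w \in W -> exists2 w', w' \in WA ++ Wl & w = w' \/ w = opp w'.
  rewrite mem_cat => /orP[ww|/mapP[w' ww ->]]; first by exists w; [|left].
  by exists w'; [|right].
have W_opp w : w \in W -> opp w \in W.
  move=> /WP[w' ww [->|->]]; rewrite mem_cat; apply/orP; [right|left].
    exact: map_f.
  by rewrite /opp /= opprK -surjective_pairing.
have WAP w : w \in WA -> exists2 p, p \in A & w = (append0 (p.1 - p.2), m (qd p)).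
  by move=> /mapP.
have WlP w : w \in Wl -> exists2 a, a \in l & w = (x - append0 a.1, m a.2).
  by move=> /mapP.
have fg_append0 (u : carrier K) : exists2 s, weighted_decomposition W s (append0 u) &
    ratr c * (total_weight s)%:R = @dist R K u 0.
  have [[s [sA s1 s2] ->] _] := dA u 0.
  exists [seq (append0 (p.1 - p.2), m (qd p)) | p <- s].
    split.
      move=> _ /mapP[p ps ->]; rewrite !mem_cat; apply/orP; left; apply/orP; left.
      by apply/mapP; exists p => //; exact: sA.
    by rewrite big_map /= -raddf_sum sumrB s1 s2 subr0.
  rewrite /total_weight big_map natr_sum mulr_sumr big_seq [RHS]big_seq.
  by apply: eq_bigr => p ps; rewrite mA//; exact: sA.
have gen v : exists s, weighted_decomposition W s v.
  (* Nonemptiness of [l] enters here: any [v] is a multiple of the letter [x - a0] plus an element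
     of [K]. *)
  have xW : (x - append0 a0.1, m a0.2) \in W.
    by rewrite !mem_cat; apply/orP; left; apply/orP; right; apply/mapP; exists a0.
  pose z := v 0 (rshift _ ord0).
  have -> : v = (x - append0 a0.1) *~ z + append0 (lsubmx v + a0.1 *~ z).
    rewrite mulrzBl raddfD /= [append0 (_ *~ _)]raddfMz /= addrCA subrK.
    rewrite -[LHS]hsubmxK /append0.
    have -> : x *~ z = row_mx 0 (rsubmx v).
      apply/rowP => j; rewrite -scaler_int !mxE.
      case: splitP => k _; rewrite !mxE ?mulr0// !ord1 mulr1.
      by rewrite intz /z; congr (v _ _); apply/val_inj.
    by rewrite add_row_mx addr0 add0r.
  have [s xs] := weighted_decomposition_mulrz z xW (W_opp _ xW).
  have [t at_ _] := fg_append0 (lsubmx v + a0.1 *~ z).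
  by exists (s ++ t); exact: weighted_decomposition_cat.
have Wpos w : w \in W -> w.2 = 0%N -> w.1 = 0.
  move=> ww w0.
  have [w' + ww'] := WP _ ww.
  have w0' : w'.2 = 0%N by case: ww' w0 => ->.
  suff : w' \in WA ++ Wl -> w'.1 = 0.
    by move=> h /h w'0; case: ww' => -> //=; rewrite w'0 oppr0.
  rewrite mem_cat => /orP[/WAP[p pA wE]|/WlP[a al wE]]; rewrite wE /= in w0' *.
    have := mA _ pA; rewrite w0' mulr0 => /d0 ->; rewrite subrr; exact: raddf0.
  have := lpos _ al; have := ml _ al; rewrite w0' mulr0 => /eqP.
  by rewrite fmorph_eq0 => /eqP ->; rewrite ltxx.
have [d' [dM' dfg' dQ' d_att d_min]] := weighted_metric R c0 W_opp Wpos gen.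
have dI' := finitely_generated_invariant dM' dfg'.
pose mu (v : 'rV[int]_(rk K + 1)) : int := v 0 (rshift _ ord0).
have lsub_append0 u : lsubmx (append0 u) = u by exact: row_mxKl.
have mu_append0 u : mu (append0 u) = 0.
  by rewrite /mu /append0 row_mxEr mxE.
have lsub_x : lsubmx x = 0 by exact: row_mxKl.
have mu_x : mu x = 1 by rewrite /mu /x row_mxEr mxE.
have muN u : mu (- u) = - mu u by rewrite /mu !mxE.
have muD u v : mu (u + v) = mu u + mu v by rewrite /mu !mxE.
have lower : forall s v, weighted_decomposition W s v ->
    exists (e : int) (t : seq (carrier K * rat)),
      [/\ {subset t <= l}, e = 1 \/ e = -1, mu v = e * (size t)%:Z &
          dist (lsubmx v + (\sum_(a <- t) a.1) *~ e) 0 + \sum_(a <- t) ratr a.2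
            <= ratr c * (total_weight s)%:R].
  apply: one_point_lower_bound => //; [exact: raddf0|exact: raddfD|by rewrite /mu mxE|].
  move=> w /WP[w' + ww]; rewrite mem_cat => /orP[/WAP[p pA wE]|/WlP[a al wE]].
    left; case: ww => ->; rewrite wE /= ?muN ?mu_append0 ?oppr0; split=> //.
      by rewrite lsub_append0 invariant_subr0// mA.
    rewrite raddfN /= lsub_append0 invariant_norm_opp//.
    by rewrite invariant_subr0// mA.
  right; exists a; case: ww => ->; rewrite wE /=.
    exists 1; split; [by []|by left| | |by rewrite ml].
      by rewrite raddfB /= lsub_append0 lsub_x sub0r mulr1z.
    by rewrite muD muN mu_append0 mu_x oppr0 addr0.
  exists (-1); split; [by []|by right| | |by rewrite ml].
    by rewrite raddfN /= raddfB /= lsub_append0 lsub_x sub0r mulrN1z.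
  by rewrite muN muD muN mu_append0 mu_x oppr0 addr0.
pose K' := FgqGroup dM' dfg' dQ'.
exists K', (@append0 (rk K) : {additive carrier K -> carrier K'}), x; split.
- split.
  + by move=> u v /(congr1 (@lsubmx _ _ _ _)); rewrite !lsub_append0.
  + move=> u v; rewrite -[LHS]/(d' (append0 u) (append0 v)).
    rewrite -(invariant_subr0 dI) -(invariant_subr0 dI') -raddfB /=.
    apply/le_anti/andP; split.
      have [s us <-] := fg_append0 (u - v); exact: d_min.
    have [s us ->] := d_att (append0 (u - v)).
    have [e [t [tl e1 muE]]] := lower _ _ us.
    move: muE; rewrite mu_append0 lsub_append0 => muE.
    (* The coefficient of [x] is 0 and equals [e * size t]. *)
    have -> : t = [::].
      apply/eqP; rewrite -size_eq0.
      by case: e1 muE => -> /eqP; rewrite ?mulN1r ?mul1r eq_sym ?oppr_eq0.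
    by rewrite !big_nil mul0rz !addr0.
  + move=> i; exists (lshift 1 i); rewrite /gen /= /append0.
    apply/rowP => j; rewrite !mxE eqxx /=.
    case: splitP => k jk; rewrite !mxE.
      by rewrite eqxx /=; congr (_ _ : nat)%:R; rewrite -!val_eqE /= jk.
    case: eqP => // /(congr1 val) /=; rewrite jk => ik.
    by have := ltn_ord i; rewrite -ik ltnNge leq_addr.
- move=> a al; rewrite -[leLHS]/(d' x (append0 a.1)) -(invariant_subr0 dI') ml//.
  have -> : m a.2 = total_weight [:: (x - append0 a.1, m a.2)].
    by rewrite /total_weight big_seq1.
  apply: d_min; split; last by rewrite big_seq1.
  move=> z; rewrite inE => /eqP->; rewrite !mem_cat.
  by apply/orP; left; apply/orP; right; apply/mapP; exists a.
- move=> a al; have -> : @dist R K' x (append0 a.1) = d' (x - append0 a.1) 0.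
    by rewrite invariant_subr0.
  have [s us ->] := d_att (x - append0 a.1).
  have [e [t [tl e1]]] := lower _ _ us.
  rewrite muD muN mu_append0 mu_x oppr0 addr0 => muE.
  (* The coefficient of [x] is now 1, so the sign is positive and the chain has exactly one
     entry. *)
  have {}e1 : e = 1 by case: e1 muE => ->; lia.
  rewrite e1 mul1r in muE *.
  case: t => [|b [|? ?]] in tl muE * => //.
  rewrite !big_seq1 mulr1z raddfB /= lsub_append0 lsub_x sub0r => bound.
  exists b; first by rewrite tl// mem_head.
  by rewrite addrC -(invariant_subr0 dI) (addrC b.1).
Qed.

(** * Urysohn spaces *)

Lemma metric_eq_near (R : realType) (T : Type) (d : T -> T -> R) (u : nat -> T) x y :
  is_metric d -> (forall e : R, 0 < e -> exists n, d x (u n) < e) ->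
  (forall n, d y (u n) = d x (u n)) -> y = x.
Proof.
move=> [d_ge0 d0 dC dT] xu yx; apply/d0/le_anti; rewrite d_ge0 andbT.
apply/ler_addgt0Pl => e e0; rewrite addr0.
have [n xn] := xu (e / 2) (divr_gt0 e0 (ltr0Sn R 1)).
have := dT y (u n) x; rewrite (dC (u n)) yx; lra.
Qed.

Lemma dense_sequence (R : realType) (T : Type) (d : T -> T -> R) :
  separable d -> T ->
  exists u : nat -> T, forall x (e : R), 0 < e -> exists n, d x (u n) < e.
Proof.
move=> [D /countable_injP[f f_inj] D_dense] x0.
(* [u n] is the point of [D] with code [n], and the default [x0] if there is none. *)
have /choice[u uP] : forall n, exists x, forall y, D y -> f y = n -> x = y.
  move=> n; have [[y [Dy fy]]|no] := pselect (exists y, D y /\ f y = n).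
    exists y => z Dz fz; apply: f_inj; rewrite ?inE//.
    by rewrite fy fz.
  by exists x0 => y Dy fy; case: no; exists y.
exists u => x e e0; have [y Dy xy] := D_dense x e e0.
by exists (f y); rewrite (uP (f y) y).
Qed.

Lemma half_pow_lt (R : realType) (a e : R) : 0 < a -> 0 < e ->
  exists n, a * 2^-1 ^+ n < e.
Proof.
move=> a0 e0; exists (Num.truncn (a / e)).+1.
have := truncnS_gt (a / e); rewrite ltr_pdivrMr// => ae.
rewrite exprVn -ltr_pdivlMr ?invr_gt0 ?exprn_gt0// invrK.
apply: (lt_trans ae); rewrite [ltRHS]mulrC ltr_pM2r// -natrX ltr_nat.
exact: ltn_expl.
Qed.

(* Each point is determined by its distances to the dense sequence [a], and a
   point of [Y] with the same distances to [b] is a limit of points [b n]. *)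
Lemma isometry_of_dense (R : realType) (X Y : Type) (dX : X -> X -> R)
    (dY : Y -> Y -> R) (a : nat -> X) (b : nat -> Y) :
  is_metric dX -> is_metric dY -> complete dY ->
  (forall x (e : R), 0 < e -> exists n, dX x (a n) < e) ->
  (forall m n, dY (b m) (b n) = dX (a m) (a n)) ->
  exists F : X -> Y, is_isometry dX dY F /\
    forall x n, dY (F x) (b n) = dX x (a n).
Proof.
move=> [dX_ge0 dX0 dXC dXT] [dY_ge0 dY0 dYC dYT] Yc a_dense ab.
suff /choice[F FP] : forall x, exists y, forall n, dY y (b n) = dX x (a n).
  exists F; split=> // x y; apply/eqP; rewrite -subr_eq0 -normr_le0.
  apply/ler_addgt0Pl => e e0; rewrite addr0.
  have [n yn] := a_dense y (e / 2) (divr_gt0 e0 (ltr0Sn R 1)).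
  have := FP x n; have := FP y n.
  have := dYT (F x) (b n) (F y); have := dYT (F x) (F y) (b n).
  have := dXT x (a n) y; have := dXT x y (a n).
  rewrite (dXC (a n)) (dYC (b n)) ler_norml; lra.
move=> x.
have /choice[k kP] : forall n, exists k, dX x (a k) < 2^-1 ^+ n.
  by move=> n; apply: a_dense; rewrite exprn_gt0 ?invr_gt0.
have k_near e : 0 < e -> exists N, forall n, (N <= n)%N -> dX x (a (k n)) < e.
  move=> e0; have [N] := half_pow_lt (@ltr01 R) e0; rewrite mul1r => Ne.
  exists N => n Nn; apply: (lt_trans (kP n)); apply: le_lt_trans Ne.
  by rewrite ler_wiXn2l ?invr_ge0 ?invf_le1 ?ler1n.
have [e e0|y yP] := Yc (b \o k).
  have [N NP] := k_near _ (divr_gt0 e0 (ltr0Sn R 1)); exists N => m n /NP Nm /NP Nn.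
  by rewrite /= ab; have := dXT (a (k m)) x (a (k n)); rewrite (dXC _ x); lra.
exists y => n; apply/eqP; rewrite -subr_eq0 -normr_le0.
apply/ler_addgt0Pl => e e0; rewrite addr0.
have [N NP] := yP _ (divr_gt0 e0 (ltr0Sn R 1)).
have [M MP] := k_near _ (divr_gt0 e0 (ltr0Sn R 1)).
have := NP (maxn N M) (leq_maxl _ _); have := MP (maxn N M) (leq_maxr _ _) => /=.
move: (k _) => i xi iy; have := ab i n.
have := dXT x (a i) (a n); have := dXT (a i) x (a n); rewrite (dXC _ x).
have := dYT y (b i) (b n); have := dYT (b i) y (b n); rewrite (dYC y (b i)).
rewrite ler_norml; lra.
Qed.

(** Dependent choice for back-and-forth arguments: [P] is the invariant of the finite stages, [Q n]
    the task of step [n], and every stage retains [s0]. *)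
Lemma sequence_of_extensions (T : choiceType) (P : seq T -> Prop)
    (Q : nat -> T -> Prop) (s0 : seq T) :
  P s0 -> (forall n s, P s -> exists2 t, Q n t & P (t :: s)) ->
  exists u : nat -> T, (forall n, Q n (u n)) /\
    forall n, exists s, [/\ P s, {subset s0 <= s} & forall i, (i < n)%N -> u i \in s].
Proof.
move=> Ps0 step; have [t0 _ _] := step 0%N _ Ps0.
have /choice[F FP] : forall ns : nat * seq T, exists t,
    P ns.2 -> Q ns.1 t /\ P (t :: ns.2).
  move=> [n s]; have [/(step n)[t Qt Pt]|nP] := pselect (P s); first by exists t.
  by exists t0.
pose S := fix S n := if n is m.+1 then F (m, S m) :: S m else s0.
have PS n : P (S n) by elim: n => //= n /(FP (n, _))[].
exists (fun n => F (n, S n)); split=> n; first by have [] := FP (n, S n) (PS n).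
exists (S n); split=> //; elim: n => //= n IH i.
  by move=> /IH; rewrite inE orbC => ->.
by rewrite ltnS leq_eqVlt inE => /orP[/eqP->|/IH->]; rewrite ?eqxx ?orbT.
Qed.

(** The list is the graph of a Katetov function on a finite set; for a metric [d], the first
    inequality forces equal values at repeated points. *)
Definition katetov (R : realType) (T : eqType) (d : T -> T -> R) (s : seq (T * R)) :=
  forall p q, p \in s -> q \in s ->
    `|p.2 - q.2| <= d p.1 q.1 /\ d p.1 q.1 <= p.2 + q.2.

(** Successive approximation: given a solution [x] with error [e n], prescribe also the distance
    [e n] to [x] and solve with error [e n.+1]. The solutions form a Cauchy sequence, whose limit is
    exact. *)
Lemma katetov_realized (R : realType) (T : eqType) (d : T -> T -> R) :
  is_metric d -> complete d ->
  (forall s, katetov d s -> forall e : R, 0 < e ->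
     exists x, forall p, p \in s -> `|d x p.1 - p.2| <= e) ->
  forall s, katetov d s -> exists x, forall p, p \in s -> d x p.1 = p.2.
Proof.
move=> [d_ge0 d0 dC dT] dc approx s sK.
have s_ge0 p : p \in s -> 0 <= p.2.
  by move=> ps; have [_] := sK p p ps ps; have := d_ge0 p.1 p.1; lra.
(* A prescribed distance 0 forces the solution to be that point. *)
have [[p ps p0]|pos] := pselect (exists2 p, p \in s & p.2 = 0).
  exists p.1 => q qs; have [] := sK p q ps qs; rewrite p0 => h1 h2.
  by apply/le_anti/andP; split; [lra|apply: le_trans h1; rewrite sub0r normrN ler_norm].
have [del del0 del_le] : exists2 del : R, 0 < del & forall p, p \in s -> del <= p.2.
  have : forall p, p \in s -> 0 < p.2.
    move=> p ps; rewrite lt_neqAle s_ge0// andbT eq_sym; apply/eqP => p0.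
    by apply: pos; exists p.
  elim: (s) => [_|p t IH tpos]; first by exists 1.
  have [|del del0 delP] := IH; first by move=> q qt; rewrite tpos// inE qt orbT.
  exists (Num.min del p.2); first by rewrite lt_min del0 tpos ?mem_head.
  by move=> q; rewrite inE ge_min => /orP[/eqP->|/delP->]; rewrite ?lexx ?orbT.
pose e n := del * 2^-1 ^+ n.
have e_gt0 n : 0 < e n by rewrite mulr_gt0// exprn_gt0 ?invr_gt0.
have eS n : e n.+1 = e n / 2 by rewrite /e exprS mulrCA mulrC.
have e_le n : e n <= del.
  by elim: n => [|n IH]; [rewrite /e mulr1|rewrite eS; have := e_gt0 n; lra].
pose close_to n x := forall p, p \in s -> `|d x p.1 - p.2| <= e n.
have /choice[F FP] : forall nx : nat * T, exists y,
    close_to nx.1 nx.2 -> close_to nx.1.+1 y /\ d nx.2 y <= 2 * e nx.1.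
  move=> [n x] /=; have [xn|] := pselect (close_to n x); last by exists x.
  (* The errors [e n] start at [del], a lower bound of all prescribed values, so [e n - q.2 <= 0]
     for every [q] in [s]; the remaining inequalities say that [x] has error at most [e n]. *)
  have xsK : katetov d ((x, e n) :: s).
    move=> p q; rewrite !inE => /orP[/eqP->|ps] /orP[/eqP->|qs] /=; last exact: sK.
    - by rewrite subrr normr0 (d0 x x).2//; have := e_gt0 n; split; lra.
    - have := xn _ qs; have := del_le _ qs; have := e_le n; have := e_gt0 n.
      by rewrite !ler_norml; lra.
    - have := xn _ ps; have := del_le _ ps; have := e_le n; have := e_gt0 n.
      by rewrite !ler_norml (dC p.1); lra.
  have [y yP] := approx _ xsK _ (e_gt0 n.+1).
  exists y => _; split; first by move=> p ps; rewrite yP// inE ps orbT.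
  have := yP _ (mem_head _ _); rewrite /= dC eS ler_norml.
  have := e_gt0 n; lra.
have [x0 x0P] := approx _ sK _ (e_gt0 0%N).
pose u := fix u n := if n is m.+1 then F (m, u m) else x0.
have u_close_to n : close_to n (u n) by elim: n => //= n /(FP (n, _))[].
have u_step n : d (u n) (u n.+1) <= 2 * e n by have [] := FP (n, u n) (u_close_to n).
(* The steps [2 * e i] form a geometric series of ratio 1/2, written in telescoped form. *)
have u_dist n k : d (u n) (u (k + n)%N) <= 4 * e n - 4 * e (k + n)%N.
  elim: k => [|k IH]; first by rewrite (d0 _ _).2// subrr.
  have := dT (u n) (u (k + n)%N) (u (k + n).+1); have := u_step (k + n)%N.
  rewrite addSn eS; lra.
have [eta eta0|l lP] := dc u.
  (* The factor is 8 because [u m] and [u n] are both within [4 * e N] of [u N]. *)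
  have [N Ne] := half_pow_lt del0 (divr_gt0 eta0 (ltr0Sn R 7)).
  exists N => m n Nm Nn; have := u_dist N (m - N)%N; have := u_dist N (n - N)%N.
  rewrite !subnK//; have := dT (u m) (u N) (u n); rewrite (dC (u m) (u N)).
  have := e_gt0 m; have := e_gt0 n; rewrite -/(e N) in Ne; lra.
exists l => p ps; apply/eqP; rewrite -subr_eq0 -normr_le0.
apply/ler_addgt0Pl => eta eta0; rewrite addr0.
have [N NP] := lP _ (divr_gt0 eta0 (ltr0Sn R 1)).
have [M ME] := half_pow_lt del0 (divr_gt0 eta0 (ltr0Sn R 1)).
have := NP (maxn N M) (leq_maxl _ _); have := u_close_to (maxn N M) p ps.
have : e (maxn N M) <= e M.
  by rewrite /e ler_pM2l// ler_wiXn2l ?leq_maxr ?invr_ge0 ?invf_le1 ?ler1n.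
rewrite -/(e M) in ME; move: (u _) (e (maxn _ _)) => y t tM yp yl.
have := dT y l p.1; have := dT l y p.1; rewrite (dC l y).
move: yp; rewrite !ler_norml; lra.
Qed.

(** The distances from [x] to the domain, prescribed at the image points, form a Katetov function on
    the range. *)
Lemma extend_partial_isometry (R : realType) (X G : choiceType)
    (dX : X -> X -> R) (d : G -> G -> R) (s : seq (X * G)) :
  is_metric dX -> is_metric d ->
  (forall s, katetov d s -> exists y, forall p, p \in s -> d y p.1 = p.2) ->
  {in s &, forall p q, d p.2 q.2 = dX p.1 q.1} ->
  forall x, exists y, {in (x, y) :: s &, forall p q, d p.2 q.2 = dX p.1 q.1}.
Proof.
move=> [dX_ge0 dX0 dXC dXT] [d_ge0 d0 dC dT] realized sP x.
have [_ _ /mapP[p ps ->] /mapP[q qs ->] /=|y yP] :=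
    realized [seq (p.2, dX x p.1) | p <- s].
  rewrite sP//; have := dXT p.1 x q.1; have := dXT x p.1 q.1.
  have := dXT x q.1 p.1; rewrite (dXC q.1) (dXC p.1 x) ler_norml; lra.
have {}yP p : p \in s -> d y p.2 = dX x p.1.
  by move=> ps; rewrite (yP (p.2, dX x p.1))//; apply: map_f ps.
exists y => p q; rewrite !inE => /orP[/eqP->|ps] /orP[/eqP->|qs] /=.
- by rewrite (d0 _ _).2// (dX0 _ _).2.
- exact: yP.
- by rewrite dC yP// dXC.
- exact: sP.
Qed.

(** Universality needs only the forth direction along a dense sequence of [X]. Homogeneity is
    back-and-forth, followed by extension from dense sequences to the whole space. *)
Lemma urysohn_criterion (R : realType) (G : choiceType) (d : G -> G -> R) :
  G -> is_metric d -> complete d -> separable d ->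
  (forall s, katetov d s -> exists y, forall p, p \in s -> d y p.1 = p.2) ->
  is_urysohn d.
Proof.
move=> y0 dM dc dsep realized; split=> //.
- move=> X dX dXM dXsep.
  have [[x0 _]|X0] := pselect (exists x : X, True); last first.
    by exists (fun _ => y0) => x; case: X0; exists x.
  have [e e_dense] := dense_sequence dXsep x0.
  have [] := @sequence_of_extensions ({classic X} * G)%type
    (fun s => {in s &, forall p q, d p.2 q.2 = dX p.1 q.1})
    (fun n p => p.1 = e n) [::].
  + by [].
  + move=> n s sP; have [y yP] := @extend_partial_isometry R {classic X} G
      dX d s dXM dM realized sP (e n).
    by exists (e n, y).
  move=> u [u1 uP].
  have [m n|F [F_iso _]] := isometry_of_dense (b := fun n => (u n).2) dXM dM dc e_dense.
    have [s [sP _ us]] := uP (maxn m n).+1.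
    by rewrite sP ?u1// us// ltnS ?leq_maxl ?leq_maxr.
  by exists F.
- move=> A f /finite_seqP[s ->] f_iso.
  have [e e_dense] := dense_sequence dsep y0.
  (* Even steps put [e n./2] into the domain, odd steps into the range by extending the inverse
     partial isometry. Both coordinate sequences are therefore dense. *)
  have [] := @sequence_of_extensions (G * G)%type
    (fun s => {in s &, forall p q, d p.2 q.2 = d p.1 q.1})
    (fun n p => if odd n then p.2 = e n./2 else p.1 = e n./2)
    [seq (x, f x) | x <- s].
  + by move=> _ _ /mapP[x xs ->] /mapP[y ys ->]; exact: f_iso.
  + move=> n t tP; case: (odd n).
      pose swap (p : G * G) := (p.2, p.1).
      have [|x xP] :=
        @extend_partial_isometry R G G d d (map swap t) dM dM realized _ (e n./2).
        by move=> _ _ /mapP[p pt ->] /mapP[q qt ->] /=; rewrite tP.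
      exists (x, e n./2) => // p q pt qt; apply/esym; apply: (xP (swap p) (swap q)).
        exact: (map_f swap pt).
      exact: (map_f swap qt).
    have [y yP] := @extend_partial_isometry R G G d d t dM dM realized tP (e n./2).
    by exists (e n./2, y).
  move=> u [ue uP].
  have u_iso m n : d (u m).2 (u n).2 = d (u m).1 (u n).1.
    have [t [tP _ ut]] := uP (maxn m n).+1.
    by rewrite tP// ut// ltnS ?leq_maxl ?leq_maxr.
  have dense1 x (r : R) : 0 < r -> exists n, d x (u n).1 < r.
    move=> r0; have [n xn] := e_dense x r r0; exists n.*2.
    by have := ue n.*2; rewrite odd_double doubleK => ->.
  have dense2 x (r : R) : 0 < r -> exists n, d x (u n).2 < r.
    move=> r0; have [n xn] := e_dense x r r0; exists n.*2.+1.
    by have := ue n.*2.+1; rewrite /= odd_double /= uphalf_double => ->.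
  have [g [g_iso gP]] := isometry_of_dense dM dM dc dense1 u_iso.
  have [h [h_iso hP]] := isometry_of_dense dM dM dc dense2
    (fun m n => esym (u_iso m n)).
  (* [h], built from the exchanged sequences, is a right inverse of [g]: [g (h y)] and [y] have
     equal distances to a dense sequence. *)
  exists g; split=> // [y|x xs].
    exists (h y); apply: (metric_eq_near dM (dense2 y)) => n.
    by rewrite gP hP.
  (* The initial pairs [(x, f x)] survive in every stage, so [f x] and [g x] have the same distances
     to the dense range points. *)
  have fu n : d (f x) (u n).2 = d x (u n).1.
    have [t [tP st ut]] := uP n.+1.
    have xt : (x, f x) \in t by apply: st; exact: map_f.
    exact: (tP _ _ xt (ut n (ltnSn n))).
  apply: (metric_eq_near (u := fun n => (u n).2) dM) => [r r0|n].
    by have [n xn] := dense1 x r r0; exists n; rewrite fu.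
  by rewrite gP fu.
Qed.

(** * The completed Fraisse limit *)

Lemma fraisse_stage (R : realType) (K : nat -> fgq_group R)
    (c : forall n, {additive carrier (K n) -> carrier (K n.+1)}) (L : zmodType)
    (g : forall n, {additive carrier (K n) -> L}) :
  (forall n x, g n.+1 (c n x) = g n x) ->
  forall n k x, g (k + n)%N (connect_map c k x) = g n x.
Proof. by move=> gc n k x; elim: k => //= k <-; exact: gc. Qed.

Lemma fraisse_common_stage (R : realType) (K : nat -> fgq_group R)
    (c : forall n, {additive carrier (K n) -> carrier (K n.+1)}) (L : zmodType)
    (g : forall n, {additive carrier (K n) -> L}) :
  (forall n x, g n.+1 (c n x) = g n x) -> (forall y, exists n x, g n x = y) ->
  forall s : seq L, exists n, forall y, y \in s -> exists x, g n x = y.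
Proof.
move=> gc g_surj; elim=> [|y s [n IH]]; first by exists 0%N.
have [m [x <-]] := g_surj y; exists (m + n)%N => z.
rewrite inE => /orP[/eqP->|/IH[w <-]].
  rewrite addnC; exists (connect_map c n x); exact: fraisse_stage.
by exists (connect_map c m w); exact: fraisse_stage.
Qed.

Lemma GG_embed (R : realType) (G : zmodType) (d : G -> G -> R) (A : fgq_group R) :
  is_GG d -> exists f : {additive carrier A -> G}, is_isometry (@dist R A) d f.
Proof.
move=> [L [dL [[K [c [_ [g [g_iso _ _]] K_univ _]]] [_ _ _ [j [j_iso _]]]]]].
have [m [f [_ f_iso _]]] := K_univ A.
exists (j \o g m \o f) => x y /=.
by rewrite j_iso g_iso f_iso.
Qed.

Lemma GG_separable (R : realType) (G : zmodType) (d : G -> G -> R) :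
  is_GG d -> separable d.
Proof.
move=> [L [dL [[K [c [_ [g [_ _ g_surj]] _ _]]] [_ _ _ [j [_ j_dense]]]]]].
exists (range j) => //; apply: (sub_countable (card_image_le _ _)).
have -> : [set: L] = \bigcup_n range (g n).
  apply/seteqP; split=> // y _; have [n [x xy]] := g_surj y.
  by exists n => //; exists x.
apply: bigcup_countable => // n _.
exact: (sub_countable (card_image_le _ _)) (countableP _).
Qed.

(** Move the points into one stage [K n], replace the values by slightly larger rationals, apply
    [one_point_extension] there, and bring the new point back by the extension property of the
    limit. *)
Lemma GG_approx (R : realType) (G : zmodType) (d : G -> G -> R) :
  is_GG d -> forall s, katetov d s -> forall e : R, 0 < e ->
  exists x, forall p, p \in s -> `|d x p.1 - p.2| <= e.
Proof.
move=> [L [dL [[K [c [_ [g [g_iso gc g_surj]] _ K_ext]]] [dM _ _ [j [j_iso j_dense]]]]]].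
case=> [|p0 s0] sK e e0; first by exists 0.
move: (p0 :: s0) (mem_head p0 s0) sK => s p0s sK.
have [d_ge0 d0 dC dT] := dM.
have e40 : 0 < e / 4 by lra.
have /choice[y yP] : forall a, exists y, d a (j y) < e / 4.
  by move=> a; have [_ [y _ <-] ay] := j_dense a _ e40; exists y.
(* Moving both points can lengthen a distance by [2 * (e / 4)]; raising each value by at least
   [e / 4] preserves the bound on [d] by the sum of the values and makes the values positive. *)
have /choice[r rP] : forall t : R, exists q : rat,
    t + e / 4 < ratr q /\ ratr q < t + 2 * (e / 4).
  move=> t; have [|q] := @rat_in_itvoo R (t + e / 4) (t + 2 * (e / 4)); first by lra.
  by rewrite in_itv /= => /andP[tq qt]; exists q.
have [n nP] := fraisse_common_stage gc g_surj [seq y p.1 | p <- s].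
have /choice[u uP] : forall p : G * R, exists u : carrier (K n),
    p \in s -> g n u = y p.1.
  move=> p; case: (boolP (p \in s)) => ps; last by exists 0.
  by have [u <-] := nP _ (map_f (fun q => y q.1) ps); exists u.
have du p q : p \in s -> q \in s -> dist (u p) (u q) = d (j (y p.1)) (j (y q.1)).
  by move=> ps qs; rewrite -g_iso -j_iso !uP.
pose l := [seq (u p, r p.2) | p <- s].
have s_ge0 p : p \in s -> 0 <= p.2.
  by move=> ps; have [_] := sK p p ps ps; have := d_ge0 p.1 p.1; lra.
have du_close_to p q : p \in s -> q \in s ->
    `|dist (u p) (u q) - d p.1 q.1| <= 2 * (e / 4).
  move=> ps qs; rewrite du//.
  have := yP p.1; have := yP q.1; move: (j _) (j _) => a b.
  have := dT p.1 a q.1; have := dT a b q.1; have := dT a p.1 b; have := dT p.1 q.1 b.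
  rewrite (dC b q.1) (dC a p.1) ler_norml; lra.
have [|||K' [rho [x [rhoM x_le x_ge]]]] := @one_point_extension R (K n) l.
- rewrite /l => /(congr1 size); rewrite size_map => /size0nil s00.
  by rewrite s00 in p0s.
- move=> _ /mapP[p ps ->] /=; rewrite -(ltr0q R).
  by have := rP p.2; have := s_ge0 _ ps; lra.
- move=> _ _ /mapP[p ps ->] /mapP[q qs ->] /=; rewrite rmorphD /=.
  have := rP p.2; have := rP q.2; have := du_close_to p q ps qs.
  by have [_] := sK p q ps qs; rewrite ler_norml; lra.
have idM : is_morphism (idfun : {additive carrier (K n) -> carrier (K n)}).
  by split=> // i; exists i.
have [k [iota [[_ iota_iso _] iotaE]]] := K_ext _ _ _ _ _ idM rhoM.
exists (j (g _ (iota x))) => p ps.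
have jx : d (j (g _ (iota x))) (j (y p.1)) = dist x (rho (u p)).
  rewrite j_iso -uP// -(fraisse_stage gc k.+1 (u p)) -[connect_map _ _ (u p)]iotaE.
  by rewrite g_iso iota_iso.
have up : (u p, r p.2) \in l by exact: map_f.
(* The upper error is at most [3 * (e / 4)]. For the lower one, the [q] from [x_ge] satisfies
   [q.2 + d q.1 p.1 >= p.2], and the approximations lose at most [e / 2]. *)
have := x_le _ up; have [_ /mapP[q qs ->]] := x_ge _ up => /=.
rewrite -jx.
have := rP p.2; have := rP q.2; have := du_close_to q p qs ps.
have [] := sK q p qs ps; have := yP p.1.
move: (j _) (j _) => a b; have := dT a b p.1; have := dT a p.1 b; rewrite (dC b p.1).
rewrite !ler_norml; lra.
Qed.

(** * The l1 plane, multiples under invariant metrics, and the non-isomorphisms *)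

(** The metric is the word metric of the letters [x], [- x], [y], [- y] with weight 1; each letter
    contributes at most its weight to the l1 norm of the sum. *)
Lemma l1_plane (R : realType) : exists (K : fgq_group R) (x y : carrier K),
  forall k l : int, (`|k|%N + `|l|%N)%:R <= @dist R K (x *~ k) (y *~ l).
Proof.
pose x : 'rV[int]_2 := delta_mx 0 0; pose y : 'rV[int]_2 := delta_mx 0 1.
pose W : seq ('rV[int]_2 * nat) := [:: (x, 1); (- x, 1); (y, 1); (- y, 1)]%N.
have W_opp w : w \in W -> (- w.1, w.2) \in W.
  by rewrite !inE => /or4P[] /eqP->; rewrite /= ?opprK !eqxx ?orbT.
have Wpos w : w \in W -> w.2 = 0%N -> w.1 = 0.
  by rewrite !inE => /or4P[] /eqP->.
have gen v : exists s, weighted_decomposition W s v.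
  have -> : v = x *~ v 0 0 + y *~ v 0 1.
    apply/rowP => i; rewrite -!scaler_int !mxE !intz.
    by case: i => [[|[|//]] ?] /=; rewrite ?mulr0 ?mulr1 ?addr0 ?add0r;
       congr (v _ _); apply/val_inj.
  have [||s xs] := @weighted_decomposition_mulrz _ W (x, 1%N) (v 0 0).
  - by rewrite !inE eqxx ?orbT.
  - by rewrite !inE eqxx ?orbT.
  have [||t yt] := @weighted_decomposition_mulrz _ W (y, 1%N) (v 0 1).
  - by rewrite !inE eqxx ?orbT.
  - by rewrite !inE eqxx ?orbT.
  by exists (s ++ t); exact: weighted_decomposition_cat.
have [d [dM dfg dQ d_att _]] := weighted_metric R ltr01 W_opp Wpos gen.
exists (FgqGroup dM dfg dQ), x, y => k l.
rewrite -[leRHS]/(d (x *~ k) (y *~ l)).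
rewrite -(invariant_subr0 (finitely_generated_invariant dM dfg)).
(* The coordinates of [v] are [k] and [- l]; rewriting with them lets the induction run over an
   arbitrary word. *)
pose v := x *~ k - y *~ l.
have -> : `|k|%N = `|v 0%R 0%R|%N.
  by rewrite /v -!scaler_int !mxE !intz /= mulr1 mulr0 subr0.
have -> : `|l|%N = `|v 0%R 1%R|%N.
  by rewrite /v -!scaler_int !mxE !intz /= mulr1 mulr0 sub0r abszN.
rewrite -/v; have [s [sW <-] ->] := d_att v.
rewrite rmorph1 mul1r ler_nat.
elim: s sW => [_|w s IH sW].
  by rewrite !big_nil !mxE.
have /IH : {subset s <= W} by move=> z zs; rewrite sW// inE zs orbT.
rewrite /total_weight !big_cons => {}IH.
have : (`|w.1 0%R 0%R| + `|w.1 0%R 1%R| <= w.2)%N.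
  have := sW w (mem_head _ _); rewrite !inE.
  by move=> /or4P[] /eqP->; rewrite !mxE.
rewrite ![in X in _ -> X]mxE; move: (w.1 0 0) (w.1 0 1) (_ 0 0) (_ 0 1) IH => a b a' b'.
lia.
Qed.

Lemma invariant_mulrn (R : realType) (G : zmodType) (d : G -> G -> R) :
  is_metric d -> is_invariant d -> forall x y n, d (x *+ n) (y *+ n) <= n%:R * d x y.
Proof.
move=> dM dI x y n; have [_ d0 _ _] := dM.
rewrite -(invariant_subr0 dI (x *+ n)) -(invariant_subr0 dI x) -mulrnBl.
elim: n => [|n IH]; first by rewrite mulr0n mul0r (d0 _ _).2.
rewrite mulrS -natr1 mulrDl mul1r addrC.
by apply: le_trans (invariant_normD dM dI _ _) _; rewrite lerD.
Qed.

Lemma invariant_mulrz (R : realType) (G : zmodType) (d : G -> G -> R) :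
  is_metric d -> is_invariant d ->
  forall x y (z : int), d (x *~ z) (y *~ z) <= (`|z|%N)%:R * d x y.
Proof.
move=> dM dI x y [] n; first exact: invariant_mulrn.
rewrite NegzE !mulrNz abszN -(invariant_subr0 dI) -opprD invariant_norm_opp//.
by rewrite invariant_subr0//; exact: invariant_mulrn.
Qed.

Theorem proposition2p9 (R : realType) (G : zmodType) (d : G -> G -> R)
    (hG : is_GG d) :
  [/\ non_periodic G,
      isometric_to_urysohn d,
      forall (H : zmodType) (dH : H -> H -> R),
        is_SN dH -> ~ isometrically_isomorphic d dH &
      forall (H : zmodType) (dH : H -> H -> R),
        is_CV dH -> ~ isometrically_isomorphic d dH].
Proof.
have [dM dI dc] : [/\ is_metric d, is_invariant d & complete d].
  by have [? [? [_ []]]] := hG.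
have [_ d0 dC dT] := dM.
have [K [x [y xy]]] := l1_plane R.
have [f f_iso] := GG_embed K hG.
have {}xy (k l : int) : (`|k|%N + `|l|%N)%:R <= d (f x *~ k) (f y *~ l).
  by rewrite -!raddfMz f_iso.
have x_free n : n%:R <= d (f x *+ n) 0.
  by have := xy n 0; rewrite addn0 mulr0z.
have half0 : 0 < 1 / 2 :> R by lra.
split.
- exists (f x) => n n0 xn0; have := x_free n.
  by rewrite xn0 (d0 0 0).2// lern0 eqn0Ngt n0.
- exists G, d; split; last by exists id; split=> // y'; exists y'.
  apply: urysohn_criterion => //; [exact: 0|exact: GG_separable|].
  by apply: katetov_realized => //; exact: GG_approx.
- move=> H dH [S [dS [[_ _ S_tors _ _] [dHM dHI _ [j [_ j_dense]]]]]] [i [i_iso _]].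
  have [_ [s _ <-] s_near] := j_dense (i (f x)) (1 / 2) half0.
  have [n n0 sn0] := S_tors s.
  have := invariant_mulrn dHM dHI (i (f x)) (j s) n.
  (* As [s *+ n = 0], its image is [0 = i 0], and the isometry [i] turns the estimate into one for
     [d (f x *+ n) 0]. *)
  rewrite -(raddfMn i) -(raddfMn j) sn0 (raddf0 j) -(raddf0 i) i_iso => le_n.
  have := x_free n; have : n%:R * dH (i (f x)) (j s) < n%:R * (1 / 2).
    by rewrite ltr_pM2l ?ltr0n.
  have : 0 < n%:R :> R by rewrite ltr0n.
  lra.
- move=> H dH [rho [_ _ _ [dHM dHI _ [j [_ j_dense]]]]] [i [i_iso _]].
  (* The dense image of [int] consists of the multiples of [j 1]. *)
  have near z : exists k : int, dH (i z) (j 1 *~ k) < 1 / 2.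
    have [_ [k _ <-] zk] := j_dense (i z) (1 / 2) half0.
    by exists k; rewrite -raddfMz /= intz.
  have [a xa] := near (f x); have [b yb] := near (f y).
  have := xy b a.
  have := invariant_mulrz dHM dHI (i (f x)) (j 1 *~ a) b.
  have := invariant_mulrz dHM dHI (i (f y)) (j 1 *~ b) a.
  have [_ dH0 dHC dHT] := dHM.
  (* The intermediate point is the [a * b] multiple of [j 1]: [b] times the approximation of [f x]
     and also [a] times that of [f y]. *)
  have := dHT (i (f x) *~ b) (j 1 *~ a *~ b) (i (f y) *~ a).
  rewrite (dHC (_ *~ a *~ b) (i (f y) *~ a)) -!mulrzA (mulrC b a) -!(raddfMz i).
  rewrite i_iso natrD.
  move=> tri by_ xb le_ab.
  have ab0 : (`|b|%N)%:R + (`|a|%N)%:R <= 0 :> R.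
    have := ler_wpM2l (ler0n R `|b|%N) (ltW xa).
    have := ler_wpM2l (ler0n R `|a|%N) (ltW yb).
    lra.
  have a0 : a = 0.
    move: ab0; rewrite -natrD lern0; lia.
  have := x_free 1%N; rewrite mulr1n -i_iso raddf0.
  by move: xa; rewrite a0 mulr0z; lra.
Qed.
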